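(* Let $\mathcal P$ be the set of $n\times n$ permutation matrices, let $X^\star$ be an $n\times n$ doubly stochastic matrix, let $\epsilon\ge 0$ be the prescribed tolerance, and define $$\mathcal I_k(\alpha)=\{P\in\mathcal P \mid X_{k-1}(a,b)+\alpha P(a,b)\le X^\star(a,b)\ \text{for all } a,b\in[n]\}$$ with $$\alpha=\sqrt{\frac{\mu_{\min}}{n}}\Bigl(1-\sum_{i=1}^{k-1}\theta_i\Bigr),\qquad \mu_{\min}=\frac1{n^3}.$$ Then $\mathcal I_k(\alpha)\neq\emptyset$, and the general Birkhoff algorithm (described in the context) with input $X^\star$ and $\epsilon$, and with the subroutine PERM described in the context, obtains an $\epsilon$-approximate decomposition with at most $$k\le 2\left[\log\left(\left(1-\min_{i\in[k]}\frac{n\theta_i^2}{\|X_{i-1}-X^\star\|_F^2}\right)^{-1}\right)\right]^{-1}\log\left(\frac{\sqrt n}{\epsilon}\right)$$ permutation matrices.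
   Context: A real $n\times n$ matrix is doubly stochastic if its entries are nonnegative and every row and every column sums to $1$; a permutation matrix is a doubly stochastic matrix with entries in $\{0,1\}$. $[n]=\{1,\dots,n\}$, $X(a,b)$ is the $(a,b)$ entry of $X$, and $\|X\|_F=\sqrt{\sum_{a,b}|X(a,b)|^2}$ is the Frobenius norm. General Birkhoff algorithm. Input: a doubly stochastic matrix $X^\star$, a tolerance $\epsilon\ge0$, and a maximum number $k_{\max}\ge1$ of admissible permutations. Set $k=1$ and $X_0=0$ (the $n\times n$ zero matrix). While $\|X_{k-1}-X^\star\|_F>\epsilon$ and $k\le k_{\max}$: call the subroutine PERM$(X_{k-1},X^\star)$, which returns a permutation matrix $P_k$ and a weight $\theta_k$; set $X_k=X_{k-1}+\theta_kP_k$; increase $k$ by $1$. Return the permutations and weights found. Thus $X_k=\sum_{i=1}^k\theta_iP_i$. The permutation and weight are required to satisfy $X_{k-1}(a,b)+\theta_kP_k(a,b)\le X^\star(a,b)$ for all $a,b\in[n]$, $\theta_k>0$, and $\sum_{i=1}^k\theta_i\le1$, for all $k\ge1$. Subroutine PERM. Given $X^\star$ and $X_{k-1}=\sum_{i=1}^{k-1}\theta_iP_i$, set $\alpha=(1-\sum_{i=1}^{k-1}\theta_i)/n^2$ (the same $\alpha$ as in the claim), take as $P_k$ any element of $\mathcal I_k(\alpha)$, and take $$\theta_k=\min_{a,b}\bigl\{(X^\star(a,b)-X_{k-1}(a,b)-1)P_k(a,b)+1\bigr\}.$$ An $\epsilon$-approximate decomposition is a collection of permutation matrices $P_1,\dots,P_k$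 and weights $\theta_1,\dots,\theta_k>0$ with $\sum_{i=1}^k\theta_i\le1$ such that $\|X^\star-\sum_{i=1}^k\theta_iP_i\|_F\le\epsilon$.
   Formalization: The bound k ≤ B can fail at the last step (e.g. when one step already reaches ε). Proved instead: k < B at each step k ≥ 1 where ε is not yet reached, and the number k of permutations returned is < max(1, B) + 1, for k_max large enough and n ≥ 1. *)

(* Defs.v *)
(* MathComp / MathComp-Analysis. *)
From HB Require Import structures.
From mathcomp Require Import all_boot all_order all_algebra all_fingroup.
From mathcomp Require Import all_classical all_reals all_analysis.

Set Implicit Arguments.
Unset Strict Implicit.
Unset Printing Implicit Defensive.

Import Order.TTheory GRing.Theory Num.Theory.
Local Open Scope classical_set_scope.
Local Open Scope ring_scope.

Definition doubly_stochastic (R : realType) (n : nat) (X : 'M[R]_n) : Prop :=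
  [/\ forall a b, 0 <= X a b,
      forall a, \sum_b X a b = 1
    & forall b, \sum_a X a b = 1].

Lemma is_perm_mxE (R : realType) (n : nat) (P : 'M[R]_n) :
  is_perm_mx P <->
  doubly_stochastic P /\ forall a b, P a b = 0 \/ P a b = 1.
Proof.
split=> [/is_perm_mxP[s ->]|[[P0 Pr Pc] P01]].
  have E a b : perm_mx s a b = (s a == b)%:R :> R by rewrite !mxE.
  split; last by move=> a b; rewrite E; case: eqP; [right|left].
  split=> [a b|a|b]; first by rewrite E ler0n.
    rewrite (bigD1 (s a)) //= E eqxx big1 ?addr0 // => b nb.
    by rewrite E eq_sym (negPf nb).
  rewrite (bigD1 (s^-1%g b)) //= E permKV eqxx big1 ?addr0 // => a na.
  rewrite E; case: eqP => // sab; case/eqP: na.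
  by rewrite -sab permK.
have ex1 a : exists b, P a b == 1.
  apply: contrapT => /forallNP H; have := Pr a.
  rewrite big1 => [/eqP|b _]; first by rewrite eq_sym oner_eq0.
  by case: (P01 a b) => // /eqP /H.
pose f a := xchoose (ex1 a).
have fP a : P a (f a) = 1 by apply/eqP/(xchooseP (ex1 a)).
have rowP a b : P a b = 1 -> b = f a.
  move=> Pab; apply/eqP; apply: contraT => nb.
  have := Pr a; rewrite (bigD1 (f a)) //= (bigD1 b) //= fP Pab.
  rewrite -[RHS]addr0 => /addrI/eqP; rewrite gt_eqF //.
  by rewrite ltr_wpDr ?sumr_ge0.
have f_inj : injective f.
  move=> a c fac; apply/eqP; apply: contraT => nac.
  have := Pc (f a); rewrite (bigD1 a) //= (bigD1 c) /=; last by rewrite eq_sym.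
  rewrite fP fac fP -[RHS]addr0 => /addrI/eqP; rewrite gt_eqF //.
  by rewrite ltr_wpDr ?sumr_ge0.
apply/is_perm_mxP; exists (perm f_inj); apply/matrixP => a b.
rewrite !mxE permE; case: eqP => [<-|nfb]; first exact: fP.
by case: (P01 a b) => // /rowP /esym.
Qed.

Definition frobenius (R : realType) (n : nat) (X : 'M[R]_n) : R :=
  Num.sqrt (\sum_a \sum_b `|X a b| ^+ 2).

(* A history [:: (P_1, theta_1); ...; (P_k, theta_k)], indexed from 0: the pair
   (P_i, theta_i) is [nth (0, 0) s i.-1], and the state after i steps is
   [partial_sum (take i s)]. *)
Definition history (R : realType) (n : nat) := seq ('M[R]_n * R).

Definition perm_at (R : realType) (n : nat) (s : history R n) (i : nat) :
  'M[R]_n := (nth (0, 0) s i).1.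

Definition weight_at (R : realType) (n : nat) (s : history R n) (i : nat) : R :=
  (nth (0, 0) s i).2.

Definition partial_sum (R : realType) (n : nat) (s : history R n) : 'M[R]_n :=
  \sum_(p <- s) p.2 *: p.1.

Definition total_weight (R : realType) (n : nat) (s : history R n) : R :=
  \sum_(p <- s) p.2.

(* The requirements that the general algorithm puts on every step. *)
Definition admissible (R : realType) (n : nat) (Xs : 'M[R]_n)
    (s : history R n) : Prop :=
  forall k, (k < size s)%N ->
    [/\ is_perm_mx (perm_at s k),
        forall a b,
          partial_sum (take k s) a b + weight_at s k * perm_at s k a b
            <= Xs a b,
        0 < weight_at s k
      & total_weight (take k.+1 s) <= 1].

(* A possibly nondeterministic subroutine: [PERM s Xs P theta] means that
   (P, theta) is a legitimate answer after history [s] on input [Xs]. *)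
Definition subroutine (R : realType) (n : nat) :=
  history R n -> 'M[R]_n -> 'M[R]_n -> R -> Prop.

Definition loop_condition (R : realType) (n : nat) (Xs : 'M[R]_n) (eps : R)
    (kmax : nat) (s : history R n) : Prop :=
  eps < frobenius (partial_sum s - Xs) /\ ((size s).+1 <= kmax)%N.

Inductive birkhoff_run (R : realType) (n : nat) (PERM : subroutine R n)
    (Xs : 'M[R]_n) (eps : R) (kmax : nat) : history R n -> Prop :=
| birkhoff_init : birkhoff_run PERM Xs eps kmax [::]
| birkhoff_step (s : history R n) (P : 'M[R]_n) (theta : R) :
    birkhoff_run PERM Xs eps kmax s ->
    loop_condition Xs eps kmax s ->
    PERM s Xs P theta ->
    birkhoff_run PERM Xs eps kmax (rcons s (P, theta)).

Definition birkhoff_returns (R : realType) (n : nat) (PERM : subroutine R n)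
    (Xs : 'M[R]_n) (eps : R) (kmax : nat) (s : history R n) : Prop :=
  birkhoff_run PERM Xs eps kmax s /\ ~ loop_condition Xs eps kmax s.

(* I_k(alpha), where [s] is the history of the first k - 1 steps. *)
Definition candidates (R : realType) (n : nat) (Xs : 'M[R]_n)
    (s : history R n) (alpha : R) : set 'M[R]_n :=
  [set P | is_perm_mx P /\
           forall a b, partial_sum s a b + alpha * P a b <= Xs a b].

Definition is_minimum (R : realType) (I : Type) (F : I -> R) (m : R) : Prop :=
  (exists i, F i = m) /\ forall i, m <= F i.

Definition PERM (R : realType) (n : nat) : subroutine R n :=
  fun s Xs P theta =>
    candidates Xs s ((1 - total_weight s) / n%:R ^+ 2) P /\
    is_minimum (fun ab : 'I_n * 'I_n =>
      (Xs ab.1 ab.2 - partial_sum s ab.1 ab.2 - 1) * P ab.1 ab.2 + 1) theta.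

Definition approx_decomposition (R : realType) (n : nat) (Xs : 'M[R]_n)
    (eps : R) (s : history R n) : Prop :=
  [/\ forall k, (k < size s)%N -> is_perm_mx (perm_at s k) /\ 0 < weight_at s k,
      total_weight s <= 1
    & frobenius (Xs - partial_sum s) <= eps].

Definition mu_min (R : realType) (n : nat) : R := (n%:R ^+ 3)^-1.

Definition decrease_ratio (R : realType) (n : nat) (Xs : 'M[R]_n)
    (s : history R n) (i : nat) : R :=
  n%:R * weight_at s i ^+ 2 / frobenius (partial_sum (take i s) - Xs) ^+ 2.

(* The start value of the fold is one of the folded values as soon as [s] is
   nonempty, so this is then the exact minimum over all steps of [s]. *)
Definition min_ratio (R : realType) (n : nat) (Xs : 'M[R]_n)
    (s : history R n) : R :=
  \big[Num.min/decrease_ratio Xs s 0]_(i < size s) decrease_ratio Xs s i.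

(* In the extended reals 1 / 0 = +oo, ln +oo = +oo, 1 / +oo = 0 and
   0 * +oo = 0: the bound is +oo when eps = 0 and 0 < min_ratio < 1, and it
   is 0 when min_ratio = 1. *)
Definition iteration_bound (R : realType) (n : nat) (Xs : 'M[R]_n) (eps : R)
    (s : history R n) : \bar R :=
  (2%:E * (lne ((1 - (min_ratio Xs s)%:E)^-1))^-1
        * lne ((Num.sqrt n%:R)%:E / eps%:E))%E.

(* Main.v *)
Require Import Defs.
From mathcomp Require Import all_boot all_order all_algebra all_fingroup.
From mathcomp Require Import all_classical all_reals all_analysis.
From mathcomp Require Import zify lra.

(** Write Y = Xs - partial_sum s for what is still to be decomposed after a
    history s, and c = 1 - total_weight s. Removing a multiple of a permutation
    matrix lowers all row and column sums by the same amount, and an admissible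
    step never exceeds an entry of Y, so Y is nonnegative with all line sums
    equal to c ([scaled_ds_residual]).

    Existence of a permutation. Since sqrt (n^-3 / n) = n^-2, the prescribed
    alpha is c / n^2. Call an entry of Y heavy if it is at least c / n^2. If the
    heavy entries of a set A of rows were confined to fewer than #|A| columns,
    then the light entries of these rows in the other columns would have to
    carry a mass of at least c; but there are at most n^2 of them and each is
    smaller than c / n^2. So Hall's theorem ([hall]) applies and yields a
    permutation on heavy entries only ([heavy_permutation]).

    Decrease. No entry of Y exceeds c <= 1, so the minimum that defines the
    weight theta is the smallest entry of Y on the permutation ([PERM_weightP]).
    Hence subtracting theta times the permutation matrix lowers the squared
    Frobenius norm by at least n * theta^2 ([sqr_frobenius_sub_perm]), that is,
    multiplies it by at most 1 - r with r the ratio that occurs in the bound. As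
    the squared norm of Xs is at most n, after k steps it is at most n * (1 -
    min r)^k ([run_contraction]). While it exceeds eps^2, taking logarithms
    gives the bound on k ([lt_log_bound]).

    Termination. Each step also turns a positive entry of Y into a zero and
    disturbs no existing zero ([card_zeros_sub_perm]), so that the tolerance,
    even eps = 0, is reached within n^2 steps whatever the choices made.

    The last step may reach the tolerance, so the logarithmic inequality is
    applied just before it; the minimum ratio over the whole run is a legitimate
    contraction rate for that shorter run too, which costs the extra 1. A run of
    a single step leaves no step before the last, which is where the maximum
    with 1 is used. *)

Set Implicit Arguments.
Unset Strict Implicit.
Unset Printing Implicit Defensive.

Import Order.TTheory GRing.Theory Num.Theory.
Local Open Scope classical_set_scope.
Local Open Scope ring_scope.

(** * Hall's marriage theorem *)

(** Rado's proof, by deletion. If some F i has two elements x and y, then one of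
    them can be deleted from F i without breaking Hall's condition: sets A and B
    of indices violating it after deleting x and y respectively would both
    contain i, and the sets A :|: B and (A :&: B) :\ i would contradict the
    condition for F by submodularity of cardinals. When no deletion is possible
    the F i are singletons, and the condition says that they are distinct. *)
Lemma hall (I T : finType) (F : I -> {set T}) :
  (forall A : {set I}, #|A| <= #|(\bigcup_(i in A) F i)%SET|)%N ->
  exists2 f : I -> T, injective f & forall i, f i \in F i.
Proof.
have [m] := ubnP (\sum_i #|F i|)%N; elim: m F => // m IHm F ltm hallF.
case: (boolP [exists i, 1 < #|F i|]%N) =>
    [/existsP[i /card_gt1P[x [y [xF yF xy]]]]|].
  pose F' (z : T) (j : I) : {set T} := if j == i then (F i :\ z)%SET else F j.
  have IHF' z : z \in F i ->
      (forall A : {set I}, #|A| <= #|(\bigcup_(i in A) F' z i)%SET|)%N ->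
      exists2 f : I -> T, injective f & forall i, f i \in F i.
    move=> zF hallF'; have [|f injf fF'] := IHm (F' z) _ hallF'.
      rewrite ltnS in ltm; apply: leq_trans ltm.
      rewrite (bigD1 i) //= [ltnRHS](bigD1 i) //=.
      rewrite {1}/F' eqxx -addSn leq_add ?(cardsD1 z (F i)) ?zF //.
      by apply: leq_sum => j /negPf nji; rewrite /F' nji.
    exists f => // j; have := fF' j; rewrite /F'; case: eqP => [->|//].
    by case/setD1P.
  pose hallP z := (forall A : {set I},
    #|A| <= #|(\bigcup_(i in A) F' z i)%SET|)%N.
  have [|] := pselect (hallP x); first exact: IHF'.
  have [hally _|] := pselect (hallP y); first exact: IHF' hally.
  move=> /existsNP[B /negP]; rewrite -ltnNge => ltB.
  move=> /existsNP[A /negP]; rewrite -ltnNge => ltA.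
  (* A set avoiding i does not see the deletion. *)
  have inC z (C : {set I}) :
      (#|(\bigcup_(j in C) F' z j)%SET| < #|C|)%N -> i \in C.
    apply: contraTT => niC; rewrite -leqNgt; apply: leq_trans (hallF C) _.
    rewrite (eq_bigr (F' z)) // => j jC; rewrite /F'.
    by case: eqP niC => // <-; rewrite jC.
  have iA := inC _ _ ltA; have iB := inC _ _ ltB.
  set NA := (\bigcup_(j in A) F' x j)%SET in ltA.
  set NB := (\bigcup_(j in B) F' y j)%SET in ltB.
  have subU : ((\bigcup_(j in A :|: B) F j)%SET \subset NA :|: NB)%SET.
    apply/bigcupsP => j jAB; apply/fintype.subsetP => z zF.
    apply/setUP; have [eji|nji] := eqVneq j i; last first.
      case/setUP: jAB => jC; [left|right]; apply/bigcupP; exists j => //;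
        by rewrite /F' (negPf nji).
    rewrite eji in zF; have [ezx|nzx] := eqVneq z x.
      right; apply/bigcupP; exists i => //.
      by rewrite /F' eqxx in_setD1 zF andbT ezx.
    by left; apply/bigcupP; exists i => //; rewrite /F' eqxx in_setD1 nzx.
  have subI : (\bigcup_(j in (A :&: B) :\ i) F j \subset NA :&: NB)%SET.
    apply/bigcupsP => j /setD1P[/negPf nji /setIP[jA jB]].
    apply/fintype.subsetP => z zF.
    by apply/setIP; split; apply/bigcupP; exists j => //; rewrite /F' nji.
  have := leq_trans (hallF _) (subset_leq_card subU).
  have := leq_trans (hallF _) (subset_leq_card subI).
  have := cardsUI NA NB; have := cardsUI A B.
  have := cardsD1 i (A :&: B)%SET; rewrite finset.in_setI iA iB /=.
  lia.
rewrite negb_exists => /forallP F1.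
have exf i : exists z, z \in F i.
  have := hallF [set i]%SET; rewrite cards1 big_set1 => /card_gt0P[z zF].
  by exists z.
have [f fF] := choice exf; exists f => // i j eqf; apply/eqP.
apply/negPn/negP => nij; have := hallF [set i; j]%SET.
rewrite cards2 nij big_setU1 ?finset.in_set1 ?big_set1 //.
suff E k : F k = [set f k]%SET by rewrite !E eqf /= finset.setUid cards1.
apply/eqP; rewrite eq_sym eqEcard finset.sub1set fF cards1.
by have := F1 k; rewrite -leqNgt.
Qed.

(** * Nonnegative matrices with constant line sums *)

Section ScaledDoublyStochastic.
Context {R : realType} {n : nat}.
Implicit Types (c : R) (Y : 'M[R]_n) (s : 'S_n).

Definition scaled_ds c Y : Prop :=
  [/\ forall a b, 0 <= Y a b, forall a, \sum_b Y a b = c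
    & forall b, \sum_a Y a b = c].

Lemma sum_row_perm_mx s a : \sum_b (perm_mx s a b : R) = 1.
Proof.
rewrite (bigD1 (s a)) //= !mxE eqxx big1 ?addr0 // => b nb.
by rewrite !mxE eq_sym (negPf nb).
Qed.

Lemma sum_col_perm_mx s b : \sum_a (perm_mx s a b : R) = 1.
Proof.
rewrite -(sum_row_perm_mx s^-1%g b); apply: eq_bigr => a _.
by rewrite !mxE (can2_eq (permK s) (permKV s)) eq_sym.
Qed.

Lemma scaled_ds_entry_le c Y a b : scaled_ds c Y -> Y a b <= c.
Proof. by case=> Y0 Yr _; rewrite -(Yr a) (bigD1 b) //= lerDl sumr_ge0. Qed.

Lemma scaled_ds_ge0 c Y : (0 < n)%N -> scaled_ds c Y -> 0 <= c.
Proof.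
by move=> n_gt0 [Y0 Yr _]; rewrite -(Yr (Ordinal n_gt0)) sumr_ge0.
Qed.

Lemma scaled_ds_sub_perm c Y s theta :
  scaled_ds c Y -> (forall a, theta <= Y a (s a)) ->
  scaled_ds (c - theta) (Y - theta *: perm_mx s).
Proof.
case=> Y0 Yr Yc thY; split=> [a b|a|b].
- rewrite !mxE; case: eqP => [<-|_]; first by rewrite mulr1 subr_ge0.
  by rewrite mulr0 subr0.
- rewrite (eq_bigr (fun b => Y a b - theta * perm_mx s a b)); last first.
    by move=> b _; rewrite !mxE.
  by rewrite sumrB -mulr_sumr sum_row_perm_mx mulr1 Yr.
- rewrite (eq_bigr (fun a => Y a b - theta * perm_mx s a b)); last first.
    by move=> a _; rewrite !mxE.
  by rewrite sumrB -mulr_sumr sum_col_perm_mx mulr1 Yc.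
Qed.

(** The counting needs a strict inequality somewhere: there is at least one
    light entry to count, since a violating set of rows is nonempty and misses a
    column. This also covers c = 0, where a light entry would be negative. *)
Lemma heavy_permutation c Y : (0 < n)%N -> scaled_ds c Y ->
  exists s : 'S_n, forall a, c / n%:R ^+ 2 <= Y a (s a).
Proof.
move=> n_gt0 Yc; have c0 := scaled_ds_ge0 n_gt0 Yc; case: Yc => Y0 Yr Yc.
set t := c / n%:R ^+ 2.
pose heavy a : {set 'I_n} := [set b | t <= Y a b]%SET.
have [A|f injf fh] := @hall _ _ heavy; last first.
  by exists (perm injf) => a; have := fh a; rewrite permE inE.
rewrite leqNgt; apply/negP; set N := (\bigcup_(a in A) heavy a)%SET => ltNA.
have inN : \sum_(a in A) \sum_(b in N) Y a b <= c *+ #|N|.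
  rewrite exchange_big /= -sumr_const ler_sum // => b _.
  by rewrite -(Yc b) [leRHS](bigID (mem A)) /= lerDl sumr_ge0.
have total : \sum_(a in A) \sum_(b in N) Y a b
             + \sum_(a in A) \sum_(b in ~: N) Y a b = c *+ #|A|.
  rewrite -big_split /= -sumr_const; apply: eq_bigr => a _.
  rewrite -(Yr a) [RHS](bigID (mem N)) /=; congr (_ + _).
  by apply: eq_bigl => b; rewrite finset.in_setC.
have [a0 a0A] : exists a, a \in A.
  by apply/card_gt0P; apply: leq_ltn_trans ltNA.
have [b0 b0N] : exists b, b \in (~: N)%SET.
  apply/card_gt0P; rewrite cardsCs finset.setCK card_ord subn_gt0.
  by apply: leq_trans ltNA _; rewrite -[leqRHS]card_ord max_card.
have light a b : a \in A -> b \in (~: N)%SET -> Y a b < t.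
  move=> aA; rewrite finset.in_setC ltNge; apply: contra => tY.
  by apply/bigcupP; exists a => //; rewrite inE.
have outN : \sum_(a in A) \sum_(b in ~: N) Y a b < t *+ (#|~: N| * #|A|).
  rewrite mulrnA -sumr_const; apply: ltr_sum => [|a aA].
    by apply/hasP; exists a0; rewrite ?mem_index_enum.
  rewrite -sumr_const; apply: ltr_sum => [|b bN]; last exact: light.
  by apply/hasP; exists b0; rewrite ?mem_index_enum.
have nn : t *+ (#|~: N| * #|A|) <= c.
  have -> : c = t *+ (n * n).
    rewrite /t -[RHS]mulr_natr natrM -expr2 mulfVK // expf_eq0 /=.
    by rewrite pnatr_eq0 -lt0n.
  rewrite ler_wpMn2l ?divr_ge0 ?exprn_ge0 //.
  by rewrite leq_mul // -[leqRHS]card_ord max_card.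
have : c *+ #|A| < c *+ #|N|.+1.
  by rewrite -total mulrSr; apply: ler_ltD => //; apply: lt_le_trans nn.
by rewrite ltNge ler_wpMn2l.
Qed.

End ScaledDoublyStochastic.

(** * Effect of one step on the Frobenius norm and on the zero entries *)

Section Frobenius.
Context {R : realType} {n : nat}.
Implicit Types (c theta : R) (X Y : 'M[R]_n) (s : 'S_n).

Lemma frobenius_ge0 Y : 0 <= frobenius Y.
Proof. exact: sqrtr_ge0. Qed.

Lemma sqr_frobenius Y : frobenius Y ^+ 2 = \sum_a \sum_b Y a b ^+ 2.
Proof.
rewrite sqr_sqrtr; last by do 2!(apply: sumr_ge0 => ? _); exact: exprn_ge0.
by do 2!(apply: eq_bigr => ? _); rewrite real_normK ?num_real.
Qed.

Lemma frobeniusBC X Y : frobenius (X - Y) = frobenius (Y - X).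
Proof.
rewrite /frobenius; congr Num.sqrt; do 2!(apply: eq_bigr => ? _).
by rewrite !mxE distrC.
Qed.

(** The entries lie in [0, 1], so their squares sum to at most their sum n. *)
Lemma sqr_frobenius_ds X : doubly_stochastic X -> frobenius X ^+ 2 <= n%:R.
Proof.
move=> Xds; have [X0 Xr _] := Xds; rewrite sqr_frobenius.
have -> : n%:R = \sum_a \sum_b X a b :> R.
  by rewrite (eq_bigr (fun=> 1)) // sumr_const card_ord.
do 2!(apply: ler_sum => ? _).
by rewrite expr2 ler_piMr // (scaled_ds_entry_le _ _ Xds).
Qed.

Lemma scaled_ds_gt0 c Y :
  (0 < n)%N -> scaled_ds c Y -> 0 < frobenius Y -> 0 < c.
Proof.
move=> n_gt0 Yc; rewrite !lt_def frobenius_ge0 (scaled_ds_ge0 n_gt0 Yc) !andbT.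
apply: contra => /eqP c0; rewrite -sqrf_eq0 sqr_frobenius.
have [Y0 _ _] := Yc; rewrite big1 // => a _; rewrite big1 // => b _.
suff -> : Y a b = 0 by rewrite expr0n.
by apply: le_anti; rewrite Y0 -c0 (scaled_ds_entry_le _ _ Yc).
Qed.

(** In each row one entry y >= theta is replaced by y - theta, and
    (y - theta)^2 = y^2 - 2 * y * theta + theta^2 <= y^2 - theta^2. *)
Lemma sqr_frobenius_sub_perm theta Y s :
  0 <= theta -> (forall a, theta <= Y a (s a)) ->
  frobenius (Y - theta *: perm_mx s) ^+ 2
    <= frobenius Y ^+ 2 - n%:R * theta ^+ 2.
Proof.
move=> th0 thY; rewrite !sqr_frobenius.
have -> : n%:R * theta ^+ 2 = \sum_(a : 'I_n) theta ^+ 2.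
  by rewrite sumr_const card_ord mulr_natl.
rewrite -sumrB; apply: ler_sum => a _.
rewrite (bigD1 (s a)) //= [in leRHS](bigD1 (s a)) //= addrAC.
apply: lerD; last first.
  apply: ler_sum => b nb; rewrite !mxE eq_sym (negPf nb).
  by rewrite mulr0 subr0.
rewrite !mxE eqxx mulr1; have := thY a; nra.
Qed.

Definition zeros Y : {set 'I_n * 'I_n} := [set p | Y p.1 p.2 == 0]%SET.

Lemma card_zeros_lt Y : 0 < frobenius Y -> (#|zeros Y| < n ^ 2)%N.
Proof.
move=> Y0; rewrite ltnNge; apply/negP => le2.
have /eqP zT : zeros Y == [set: 'I_n * 'I_n]%SET.
  by rewrite eqEcard finset.subsetT cardsT card_prod card_ord mulnn.
suff : frobenius Y ^+ 2 = 0 by apply/eqP; rewrite gt_eqF ?exprn_gt0.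
rewrite sqr_frobenius big1 // => a _; rewrite big1 // => b _.
have : (a, b) \in zeros Y by rewrite zT finset.in_setT.
by rewrite inE => /eqP ->; rewrite expr0n.
Qed.

(** Entries on the permutation are positive, so the old zeros are left alone,
    while the entry that attains theta becomes a new one. *)
Lemma card_zeros_sub_perm theta Y s a0 :
  0 < theta -> (forall a, theta <= Y a (s a)) -> Y a0 (s a0) = theta ->
  (#|zeros Y| < #|zeros (Y - theta *: perm_mx s)%R|)%N.
Proof.
move=> th0 thY Ya0; apply: proper_card; apply/fintype.properP; split.
  apply/fintype.subsetP => -[a b]; rewrite !inE /= => /eqP Yab; rewrite !mxE /=.
  have [eb|_] := eqVneq (s a) b; last by rewrite Yab mulr0 subr0.
  by have := thY a; rewrite eb Yab leNgt th0.
exists (a0, s a0); rewrite !inE /= ?mxE ?eqxx ?mulr1 ?Ya0 ?subrr //.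
by rewrite gt_eqF.
Qed.

End Frobenius.

(** * Histories and the subroutine *)

Section Histories.
Context {R : realType} {n : nat}.
Implicit Types (Xs P : 'M[R]_n) (s : history R n) (theta : R).

Definition residual Xs s : 'M[R]_n := Xs - partial_sum s.

Lemma residual_nil Xs : residual Xs [::] = Xs.
Proof. by rewrite /residual /partial_sum big_nil subr0. Qed.

Lemma residual_rcons Xs s P theta :
  residual Xs (rcons s (P, theta)) = residual Xs s - theta *: P.
Proof. by rewrite /residual /partial_sum big_rcons /= opprD addrA. Qed.

Lemma total_weight_rcons s P theta :
  total_weight (rcons s (P, theta)) = total_weight s + theta.
Proof. by rewrite /total_weight big_rcons. Qed.

Lemma admissible_nil Xs : admissible Xs [::].
Proof. by []. Qed.

(** Turns the indexed definition of admissibility into a recursive one, which is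
    what inductions on histories and on runs use. *)
Lemma admissible_rcons Xs s P theta :
  admissible Xs (rcons s (P, theta)) <->
  admissible Xs s /\
  [/\ is_perm_mx P, forall a b, partial_sum s a b + theta * P a b <= Xs a b,
      0 < theta & total_weight s + theta <= 1].
Proof.
have old k : (k < size s)%N ->
    [/\ perm_at (rcons s (P, theta)) k = perm_at s k,
        weight_at (rcons s (P, theta)) k = weight_at s k,
        take k (rcons s (P, theta)) = take k s
      & take k.+1 (rcons s (P, theta)) = take k.+1 s].
  move=> ks; rewrite /perm_at /weight_at nth_rcons ks -cats1.
  by rewrite !takel_cat // ltnW.
have new : [/\ perm_at (rcons s (P, theta)) (size s) = P,
               weight_at (rcons s (P, theta)) (size s) = theta,
               take (size s) (rcons s (P, theta)) = s
             & take (size s).+1 (rcons s (P, theta)) = rcons s (P, theta)].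
  rewrite /perm_at /weight_at nth_rcons ltnn eqxx; split => //.
    by rewrite -cats1 take_size_cat.
  by rewrite -(size_rcons s (P, theta)) take_size.
rewrite -(total_weight_rcons s P); split=> [adm|[adm step] k].
  split=> [k ks|].
    have := adm k; rewrite size_rcons ltnS (ltnW ks).
    by have [-> -> -> ->] := old k ks; apply.
  have := adm (size s); rewrite size_rcons ltnSn.
  by have [-> -> -> ->] := new; apply.
rewrite size_rcons ltnS leq_eqVlt => /predU1P[->|ks].
  by have [-> -> -> ->] := new.
by have [-> -> -> ->] := old k ks; apply: adm.
Qed.

Lemma le_perm_mxP Xs s theta (u : 'S_n) :
  (forall a b, 0 <= residual Xs s a b) ->
  (forall a b, partial_sum s a b + theta * perm_mx u a b <= Xs a b) <->
  (forall a, theta <= residual Xs s a (u a)).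
Proof.
move=> Y0; split=> [le a|le a b].
  by have := le a (u a); rewrite !mxE eqxx mulr1 lerBrDl.
rewrite [perm_mx u a b]mxE mxE; case: eqP => [<-|_].
  by rewrite mulr1 -lerBrDl; have := le a; rewrite !mxE.
by rewrite mulr0 addr0 -subr_ge0; have := Y0 a b; rewrite !mxE.
Qed.

Lemma total_weight_ge0 Xs s : admissible Xs s -> 0 <= total_weight s.
Proof.
elim/last_ind: s => [_|s [P theta] IHs]; first by rewrite /total_weight big_nil.
rewrite total_weight_rcons.
by move=> /admissible_rcons[/IHs w0 [_ _ /ltW th0 _]]; rewrite addr_ge0.
Qed.

Lemma scaled_ds_residual Xs s : doubly_stochastic Xs -> admissible Xs s ->
  scaled_ds (1 - total_weight s) (residual Xs s).
Proof.
move=> Xds; elim/last_ind: s => [_|s [P theta] IHs].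
  by rewrite /total_weight big_nil residual_nil subr0.
move=> /admissible_rcons[/IHs ds [/is_perm_mxP[u ->] le _ _]].
rewrite total_weight_rcons residual_rcons opprD addrA.
have [Y0 _ _] := ds.
by apply: scaled_ds_sub_perm => //; apply/le_perm_mxP.
Qed.

Lemma candidates_neq0 Xs s : (0 < n)%N -> doubly_stochastic Xs ->
  admissible Xs s ->
  candidates Xs s ((1 - total_weight s) / n%:R ^+ 2) !=set0.
Proof.
move=> n_gt0 Xds adm; have ds := scaled_ds_residual Xds adm.
have [u le] := heavy_permutation n_gt0 ds; exists (perm_mx u).
split; first exact: perm_mx_is_perm.
by apply/le_perm_mxP => //; case: ds.
Qed.

Lemma is_minimum_exists (I : finType) (F : I -> R) (i0 : I) :
  exists m, is_minimum F m.
Proof.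
case: (@Order.TotalTheory.arg_minP _ R I i0 xpredT F isT) => i _ le.
by exists (F i); split=> [|j]; [exists i | exact: le].
Qed.

Lemma PERM_total Xs s : (0 < n)%N -> doubly_stochastic Xs ->
  admissible Xs s -> exists P theta, PERM s Xs P theta.
Proof.
move=> n_gt0 Xds adm; have [P Pc] := candidates_neq0 n_gt0 Xds adm.
pose i0 : 'I_n := Ordinal n_gt0; exists P.
by have [theta thP] := is_minimum_exists (fun ab : 'I_n * 'I_n =>
  (Xs ab.1 ab.2 - partial_sum s ab.1 ab.2 - 1) * P ab.1 ab.2 + 1) (i0, i0);
  exists theta.
Qed.

(** The expression minimised by theta is the residual entry on the permutation
    and 1 off it. If the minimum 1 is attained off the permutation, in row a,
    then the residual entry of row a on the permutation is at least 1, hence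
    equal to 1 because no entry exceeds the line sum 1 - total_weight s <= 1:
    theta is attained on the permutation in every case. *)
Lemma PERM_weightP Xs s P theta : doubly_stochastic Xs ->
  admissible Xs s -> PERM s Xs P theta ->
  exists u : 'S_n,
    [/\ P = perm_mx u, forall a, theta <= residual Xs s a (u a),
        exists a, residual Xs s a (u a) = theta
      & (1 - total_weight s) / n%:R ^+ 2 <= theta].
Proof.
move=> Xds adm [[/is_perm_mxP[u ->] le] [[[a b] /= eqth] minth]].
have ds := scaled_ds_residual Xds adm; have [Y0 _ _] := ds.
have {}le := (le_perm_mxP _ _ Y0).1 le.
have thu a' : theta <= residual Xs s a' (u a').
  by have := minth (a', u a'); rewrite /= !mxE eqxx mulr1 subrK.
have eqthu : residual Xs s a (u a) = theta.
  move: eqth; rewrite [perm_mx u a b]mxE mxE; case: eqP => [<-|_].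
    by rewrite mulr1 subrK !mxE.
  rewrite mulr0 add0r => th1; apply: le_anti; rewrite thu andbT -th1.
  apply: le_trans (scaled_ds_entry_le _ _ ds) _.
  by rewrite gerBl (total_weight_ge0 adm).
by exists u; split=> //; [exists a | rewrite -eqthu].
Qed.

End Histories.

(** * From geometric decay to the logarithmic bound *)

Section LogBound.
Context {R : realType}.
Implicit Types (m eps : R) (n k : nat).
Local Open Scope ereal_scope.

(** For eps > 0 this is the logarithm of the hypothesis. For eps = 0 the last
    factor is +oo and the other one is positive, so the bound is +oo. *)
Lemma lt_log_bound n k m eps : (0 < n)%N -> (0 < m < 1)%R -> (0 <= eps)%R ->
  (eps ^+ 2 < n%:R * (1 - m) ^+ k)%R ->
  k%:R%:E < 2%:E * (lne ((1 - m%:E)^-1))^-1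
            * lne ((Num.sqrt n%:R)%:E / eps%:E).
Proof.
move=> n_gt0 /andP[m0 m1] eps0 lek.
have q0 : (0 < 1 - m)%R by rewrite subr_gt0.
have L0 : (0 < ln (1 - m)^-1)%R by rewrite ln_gt0 // invf_gt1 ?gtrBl.
have n0 : (0 < n%:R :> R)%R by rewrite ltr0n.
have rn0 : (0 < Num.sqrt n%:R :> R)%R by rewrite sqrtr_gt0.
rewrite -EFinB inver gt_eqF // lne_EFin ?invr_gt0 // inver gt_eqF // -EFinM.
have c0 : (0 < 2 * (ln (1 - m)^-1)^-1 :> R)%R by rewrite mulr_gt0 ?invr_gt0.
have [->|epsN0] := eqVneq eps 0%R.
  by rewrite inve0 gt0_muley ?lte_fin //= gt0_muley ?lte_fin // ltry.
have {epsN0}eps0 : (0 < eps)%R by rewrite lt_def epsN0.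
rewrite inver gt_eqF // -EFinM lne_EFin ?divr_gt0 // -EFinM lte_fin.
rewrite mulrAC ltr_pdivlMr // ln_div // lnV //.
have := lek; rewrite -ltr_ln ?posrE ?exprn_gt0 ?mulr_gt0 ?exprn_gt0 //.
rewrite lnXn // lnM ?posrE ?exprn_gt0 // lnXn //.
rewrite -[in ln n%:R](sqr_sqrtr (ltW n0)).
rewrite lnXn //; set a := ln _; set b := ln _; set c := ln _.
rewrite -[(c *+ k)%R]mulr_natl; lra.
Qed.

End LogBound.

(** * Runs of the algorithm *)

Section Runs.
Context {R : realType} {n : nat}.
Context (Xs : 'M[R]_n) (eps : R) (kmax : nat).
Context (n_gt0 : (0 < n)%N) (Xs_ds : doubly_stochastic Xs) (eps_ge0 : 0 <= eps).
Implicit Types (s : history R n) (P : 'M[R]_n) (theta : R).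

Local Notation run := (birkhoff_run (@PERM R n) Xs eps kmax).

Lemma loop_residual s :
  loop_condition Xs eps kmax s -> eps < frobenius (residual Xs s).
Proof. by case=> + _; rewrite frobeniusBC. Qed.

(** As long as the loop goes on the residual is nonzero, so its line sum c is
    positive, and theta >= c / n^2. *)
Lemma loop_weight_gt0 s P theta : admissible Xs s ->
  loop_condition Xs eps kmax s -> PERM s Xs P theta -> 0 < theta.
Proof.
move=> adm /loop_residual/(le_lt_trans eps_ge0) Y0 Pth.
have c0 := scaled_ds_gt0 n_gt0 (scaled_ds_residual Xs_ds adm) Y0.
have [u [_ _ _ /(lt_le_trans _)->//]] := PERM_weightP Xs_ds adm Pth.
by rewrite divr_gt0 ?exprn_gt0 ?ltr0n.
Qed.

(** The total weight stays at most 1 because 1 - total_weight is a line sum of a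
    nonnegative matrix. *)
Lemma run_admissible s : run s -> admissible Xs s.
Proof.
elim=> [|{}s P theta _ adm lc Pth]; first exact: admissible_nil.
have th0 := loop_weight_gt0 adm lc Pth.
have [u [Pu thY _ _]] := PERM_weightP Xs_ds adm Pth; subst P.
have ds := scaled_ds_residual Xs_ds adm.
have [Y0 _ _] := ds.
apply/admissible_rcons; split=> //; split=> //.
- exact: perm_mx_is_perm.
- exact/le_perm_mxP.
- rewrite -lerBrDl -subr_ge0.
  exact: scaled_ds_ge0 (scaled_ds_sub_perm ds thY).
Qed.

Lemma run_step s P theta : run s -> loop_condition Xs eps kmax s ->
  PERM s Xs P theta ->
  [/\ 0 < theta,
      frobenius (residual Xs (rcons s (P, theta))) ^+ 2
        <= frobenius (residual Xs s) ^+ 2 - n%:R * theta ^+ 2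
    & (#|zeros (residual Xs s)|
        < #|zeros (residual Xs (rcons s (P, theta)))|)%N].
Proof.
move=> /run_admissible adm lc Pth; have th0 := loop_weight_gt0 adm lc Pth.
have [u [-> thY [a Ya] _]] := PERM_weightP Xs_ds adm Pth.
rewrite residual_rcons; split=> //; last exact: card_zeros_sub_perm Ya.
by apply: sqr_frobenius_sub_perm => //; exact: ltW.
Qed.

Lemma run_extends s : run s ->
  exists t, birkhoff_returns (@PERM R n) Xs eps kmax (s ++ t).
Proof.
have [m] := ubnP (kmax - size s)%N; elim: m s => // m IHm s ltm rs.
have [lc|nlc] := pselect (loop_condition Xs eps kmax s); last first.
  by exists [::]; rewrite cats0.
have [P [theta Pth]] := PERM_total n_gt0 Xs_ds (run_admissible rs).
have [|t rt] := IHm (rcons s (P, theta)) _ (birkhoff_step rs lc Pth).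
  by case: lc => _; rewrite size_rcons; lia.
by exists ((P, theta) :: t); rewrite -cat_rcons.
Qed.

Lemma run_size_zeros s : run s -> (size s <= #|zeros (residual Xs s)|)%N.
Proof.
elim=> // {}s P theta rs lez lc Pth; rewrite size_rcons.
by have [_ _] := run_step rs lc Pth; apply: leq_ltn_trans.
Qed.

Lemma decrease_ratioE s i :
  decrease_ratio Xs s i
    = n%:R * weight_at s i ^+ 2 / frobenius (residual Xs (take i s)) ^+ 2.
Proof. by rewrite /decrease_ratio frobeniusBC. Qed.

Lemma decrease_ratio_rcons_lt s p i : (i < size s)%N ->
  decrease_ratio Xs (rcons s p) i = decrease_ratio Xs s i.
Proof.
move=> ltis; rewrite /decrease_ratio /weight_at nth_rcons ltis -cats1.
by rewrite takel_cat // ltnW.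
Qed.

Lemma decrease_ratio_rcons_last s P theta :
  decrease_ratio Xs (rcons s (P, theta)) (size s)
    = n%:R * theta ^+ 2 / frobenius (residual Xs s) ^+ 2.
Proof.
rewrite decrease_ratioE /weight_at nth_rcons ltnn eqxx -cats1.
by rewrite take_size_cat.
Qed.

(** The bound r <= 1 follows from the decrease itself, as the squared norm after
    the step is nonnegative. *)
Lemma run_decrease s P theta : run s -> loop_condition Xs eps kmax s ->
  PERM s Xs P theta ->
  let r := decrease_ratio Xs (rcons s (P, theta)) (size s) in
  0 < r <= 1 /\
  frobenius (residual Xs (rcons s (P, theta))) ^+ 2
    <= frobenius (residual Xs s) ^+ 2 * (1 - r).
Proof.
move=> rs lc Pth r; have [th0 dec _] := run_step rs lc Pth.
have Y0 : 0 < frobenius (residual Xs s) ^+ 2.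
  by rewrite exprn_gt0 // (le_lt_trans eps_ge0) // loop_residual.
have rE : n%:R * theta ^+ 2 = frobenius (residual Xs s) ^+ 2 * r.
  by rewrite /r decrease_ratio_rcons_last [RHS]mulrC mulfVK // gt_eqF.
split; last by rewrite mulrBr mulr1 -rE.
rewrite -[0 < r](pmulr_rgt0 _ Y0) -rE mulr_gt0 ?exprn_gt0 ?ltr0n //=.
rewrite -(ler_pM2l Y0) -rE mulr1 -subr_ge0.
by apply: le_trans dec; exact: exprn_ge0 (frobenius_ge0 _).
Qed.

Lemma run_ratios s i : run s -> (i < size s)%N ->
  0 < decrease_ratio Xs s i <= 1.
Proof.
elim=> // {}s P theta rs IHs lc Pth.
rewrite size_rcons ltnS leq_eqVlt => /predU1P[->|ltis].
  by have [] := run_decrease rs lc Pth.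
by rewrite decrease_ratio_rcons_lt // IHs.
Qed.

Lemma run_contraction s m : run s -> m <= 1 ->
  (forall i, (i < size s)%N -> m <= decrease_ratio Xs s i) ->
  frobenius (residual Xs s) ^+ 2 <= n%:R * (1 - m) ^+ size s.
Proof.
move=> + m1; elim=> [|{}s P theta rs IHs lc Pth] mr.
  by rewrite residual_nil mulr1 sqr_frobenius_ds.
have [_ /le_trans->//] := run_decrease rs lc Pth.
rewrite size_rcons [in leRHS]exprSr mulrA ler_pM ?exprn_ge0 ?frobenius_ge0 //.
- rewrite subr_ge0.
  by have [/andP[]] := run_decrease rs lc Pth.
- apply: IHs => i ltis; rewrite -(decrease_ratio_rcons_lt (P, theta)) //.
  by rewrite mr // size_rcons ltnS ltnW.
- by rewrite lerD2l lerN2 mr // size_rcons.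
Qed.

Lemma run_min_ratio s : run s -> (0 < size s)%N ->
  0 < min_ratio Xs s <= 1 /\
  forall i, (i < size s)%N -> min_ratio Xs s <= decrease_ratio Xs s i.
Proof.
move=> rs s0; have ler i : (i < size s)%N ->
    min_ratio Xs s <= decrease_ratio Xs s i.
  move=> ltis.
  exact: (bigmin_le _ (Ordinal ltis) (fun i => decrease_ratio Xs s i)).
split=> //; apply/andP; split.
  apply: lt_bigmin => [|i _]; last by have /andP[] := run_ratios rs (ltn_ord i).
  by have /andP[] := run_ratios rs s0.
by apply: le_trans (ler _ s0) _; have /andP[] := run_ratios rs s0.
Qed.

(** The rate m is kept free so that the lemma applies both with the minimum
    ratio of s and with the possibly smaller one of a longer run. The value m =
    1 is excluded by the norm still exceeding eps after at least one step. *)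
Lemma run_size_lt s m : run s -> (0 < size s)%N ->
  eps < frobenius (residual Xs s) -> 0 < m <= 1 ->
  (forall i, (i < size s)%N -> m <= decrease_ratio Xs s i) ->
  ((size s)%:R%:E < 2%:E * (lne ((1 - m%:E)^-1))^-1
                    * lne ((Num.sqrt n%:R)%:E / eps%:E))%E.
Proof.
move=> rs s0 epsY /andP[m0 m1] mr.
have lt2 : eps ^+ 2 < n%:R * (1 - m) ^+ size s.
  apply: lt_le_trans (run_contraction rs m1 mr).
  by rewrite ltr_pXn2r ?nnegrE ?frobenius_ge0.
apply: lt_log_bound => //; rewrite m0 lt_def m1 andbT.
apply: contraTneq lt2 => <-; rewrite subrr expr0n gtn_eqF // mulr0.
by rewrite -leNgt exprn_ge0.
Qed.

End Runs.

(** * The theorem *)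

Theorem theorem1 (R : realType) (n : nat) (Xs : 'M[R]_n) (eps : R)
    (n_gt0 : (0 < n)%N) (Xs_ds : doubly_stochastic Xs) (eps_ge0 : 0 <= eps) :
  [/\ (* I_k(alpha) is nonempty at every state of the general algorithm *)
      forall s : history R n, admissible Xs s ->
        candidates Xs s
          (Num.sqrt (mu_min R n / n%:R) * (1 - total_weight s)) !=set0,
      (* with PERM, every run meets the requirements of the general algorithm
         and can be continued until the algorithm returns *)
      forall (kmax : nat) (s : history R n), (0 < kmax)%N ->
        birkhoff_run (@PERM R n) Xs eps kmax s ->
        admissible Xs s /\
        exists t, birkhoff_returns (@PERM R n) Xs eps kmax (s ++ t),
      (* the inequality of the theorem holds verbatim as long as the
         tolerance has not been reached *)
      forall (kmax : nat) (s : history R n), (0 < kmax)%N ->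
        birkhoff_run (@PERM R n) Xs eps kmax s ->
        (0 < size s)%N -> eps < frobenius (partial_sum s - Xs) ->
        ((size s)%:R%:E < iteration_bound Xs eps s)%E
    & (* if kmax is not too small, whatever is returned is an eps-approximate
         decomposition; its length is at most the bound, rounded up to a
         positive integer *)
      exists kmax0 : nat, forall (kmax : nat) (s : history R n),
        (0 < kmax)%N -> (kmax0 <= kmax)%N ->
        birkhoff_returns (@PERM R n) Xs eps kmax s ->
        approx_decomposition Xs eps s /\
        ((size s)%:R%:E < maxe 1 (iteration_bound Xs eps s) + 1)%E].
Proof.
have size_lt kmax s : (0 < size s)%N ->
    birkhoff_run (@PERM R n) Xs eps kmax s ->
    eps < frobenius (residual Xs s) ->
    ((size s)%:R%:E < iteration_bound Xs eps s)%E.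
  move=> s0 rs epsY; have [mr ler] := run_min_ratio n_gt0 Xs_ds eps_ge0 rs s0.
  exact: (run_size_lt n_gt0 Xs_ds eps_ge0 rs s0 epsY mr ler).
split=> [s adm|kmax s _ rs|kmax s _ rs s0|].
- have -> : Num.sqrt (mu_min R n / n%:R) = (n%:R ^+ 2)^-1.
    have n0 : n%:R != 0 :> R by rewrite pnatr_eq0 -lt0n.
    rewrite /mu_min -invfM -exprSr -[4%N]/(2 * 2)%N exprM -exprVn sqrtr_sqr.
    by rewrite ger0_norm // invr_ge0 exprn_ge0.
  by rewrite mulrC; exact: candidates_neq0.
- split; first exact: run_admissible rs.
  exact: run_extends rs.
- by rewrite frobeniusBC; apply: size_lt s0 rs.
exists (n ^ 2)%N => kmax s _ le_kmax [rs nlc].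
have adm := run_admissible n_gt0 Xs_ds eps_ge0 rs.
have le_eps : frobenius (residual Xs s) <= eps.
  rewrite leNgt; apply/negP => epsY; apply: nlc; split.
    by rewrite frobeniusBC.
  apply: leq_trans le_kmax.
  apply: leq_ltn_trans (run_size_zeros n_gt0 Xs_ds eps_ge0 rs) _.
  by apply: card_zeros_lt; apply: le_lt_trans eps_ge0 _.
split.
  split=> // [k ks|]; first by have [] := adm k ks.
  by rewrite -subr_ge0; exact: scaled_ds_ge0 (scaled_ds_residual Xs_ds adm).
have pos1 (x : \bar R) : (0 < maxe 1 x + 1)%E.
  by rewrite adde_gt0 ?lt_max ?lte01 //.
case: rs le_eps {nlc adm} => [|{}s P theta rs lc Pth] le_eps; first exact: pos1.
rewrite size_rcons -addn1 natrD EFinD lteD2rE //.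
have [s0|s0] := posnP (size s); first by rewrite s0 lt_max lte01.
rewrite lt_max; apply/orP; right.
(* The run without its last step is bounded with the rate of the whole run. *)
have rs' := birkhoff_step rs lc Pth.
have [] := run_min_ratio n_gt0 Xs_ds eps_ge0 rs'; first by rewrite size_rcons.
move=> mr ler; apply: (run_size_lt n_gt0 Xs_ds eps_ge0 rs) => //.
  exact: loop_residual lc.
move=> i ltis; rewrite -(decrease_ratio_rcons_lt _ (P, theta) ltis).
by rewrite ler // size_rcons ltnS ltnW.
Qed.
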